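(* Let $z\in\mathcal{T}$, $w\in\mathcal{T}\setminus\{0\}$ and $\varepsilon>0$ with $\langle z,w\rangle>\varepsilon$, where $z,w\in\mathbf{R}^n$, and let $$x^\ast:=\operatorname*{argmin}_{x\in\mathbf{R}^n}\tfrac12\|x-z\|^2\quad\text{subject to } \sum_{i=1}^n w_ix_i=\varepsilon \text{ and } x_1\ge x_2\ge\cdots\ge x_n\ge0.$$ Then Algorithm A (described in the context), run on input $(z,w,\varepsilon)$, terminates after at most $n$ outer loops, and its output is $x^\ast$.
   Context: Notation. $\mathcal{T}:=\{x\in\mathbf{R}^n \mid x_1\ge x_2\ge\cdots\ge x_n\ge 0\}$, and $\langle\cdot,\cdot\rangle$, $\|\cdot\|$ are the Euclidean inner product and norm. $\mathcal{P}_n$ is the set of partitions of $\{1,\dots,n\}$ all of whose members are intervals of consecutive integers. For $y\in\mathbf{R}^n$, $\mathcal{G}(y)\in\mathcal{P}_n$ is the partition of $\{1,\dots,n\}$ into the maximal intervals on which $y$ is nondecreasing, i.e. $i$ and $i+1$ lie in the same group if and only if $y_i\le y_{i+1}$. For $y\in\mathbf{R}^n$ and $\mathcal{G}\in\mathcal{P}_n$, the averaged vector $y_{\mathcal{G}}\in\mathbf{R}^n$ is given by $(y_{\mathcal{G}})_i:=\frac{1}{|G|}\sum_{k\in G}y_k$ for $i\in G\in\mathcal{G}$. For $\kappa>0$, $\Delta(\kappa,n):=\{x\in\mathbf{R}^n\mid 0\le x_i\le\kappa \text{ for all } i,\ \sum_{i=1}^n x_i=\kappa\}$, and $P_C$ denotes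 Euclidean projection onto a closed convex set $C$. Algorithm A. Input: $z\in\mathcal{T}$, $w\in\mathcal{T}\setminus\{0\}$, $\varepsilon>0$. Initialize: $w\leftarrow w_{\mathcal{G}(z)}$. Repeat (one pass is one outer loop): 1. Compute $r\leftarrow\min\{\frac{z_i-z_{i+1}}{w_i-w_{i+1}}\mid i=1,\dots,n-1\}$ (a ratio with zero denominator is $\infty$, including $0/0=\infty$; the minimum of the empty set is $\infty$); $\lambda_0\leftarrow\frac{\left(\sum_{\{i\mid z_i>z_n\}}z_iw_i\right)-\varepsilon}{\sum_{\{i\mid z_i>z_n\}}w_i^2}$; $\lambda_1\leftarrow\frac{\langle z,w\rangle-\varepsilon}{\|w\|^2}$; $n'\leftarrow\min(\{k\mid z_k-\lambda_0w_k<0\}\cup\{n+1\})$; $\mathcal{G}_0\leftarrow\{G\in\mathcal{G}(z)\mid\max(G)<n'\}\cup\{\{n',\dots,n\}\}$. (If $z$ is constant, $\lambda_0$, $n'$, $\mathcal{G}_0$ are not needed, because then $r=\infty$ and the algorithm exits in test (a) or (b).) 2. Tests, in order: (a) If $\langle z,w\rangle\le\varepsilon$: output $z$ and exit. (b) If $r=\infty$: output $P_{\Delta(\varepsilon/w_1,n)}(z)$ and exit. (c) If $\lambda_1>r$: with $\mathcal{G}:=\mathcal{G}(z-\lambda_1w)$, replace $(z,w)$ by $(z_{\mathcal{G}},w_{\mathcal{G}})$ and go to step 1. (d) If $\lambda_1\le r<\infty$ and $z_n-\lambda_1w_n\ge0$: output $z-\lambda_1w$ and exit. (e) If $\lambda_1\le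 r<\infty$, $z_n-\lambda_1w_n<0$ and $\lambda_0>r$: with $\mathcal{G}:=\mathcal{G}(z-\lambda_0w)$, replace $(z,w)$ by $(z_{\mathcal{G}},w_{\mathcal{G}})$ and go to step 1. (f) If $\lambda_1\le r<\infty$, $z_n-\lambda_1w_n<0$, $\lambda_0\le r$, and $n'\le n$ with $z_{n'}=z_n$: output $\max\{z-\lambda_0w,0\}$ (componentwise) and exit. (g) If $\lambda_1\le r<\infty$, $z_n-\lambda_1w_n<0$, $\lambda_0\le r$, and $n'<n$ with $z_{n'}\ne z_n$: replace $(z,w)$ by $(z_{\mathcal{G}_0},w_{\mathcal{G}_0})$ and go to step 1. *)

(* Defs.v *)
From mathcomp Require Import all_boot all_order all_algebra.
From mathcomp Require Import boolp classical_sets reals constructive_ereal.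

Set Implicit Arguments.
Unset Strict Implicit.
Unset Printing Implicit Defensive.

Import Order.TTheory GRing.Theory Num.Theory.
Local Open Scope ring_scope.

(* Vectors of R^N with N >= 1 are row vectors 'rV[R]_n.+1 (N = n.+1), indexed
   from 0: x_1 is x 0 ord0, x_N is x 0 ord_max, and for i : 'I_n the two
   consecutive positions i, i + 1 are (lift ord_max i) and (lift ord0 i). *)

Definition dot (R : realType) (n : nat) (x y : 'rV[R]_n) : R :=
  \sum_(i < n) x 0 i * y 0 i.

(* The Euclidean norm; the library norm `|x| on matrices is the sup norm. *)
Definition enorm (R : realType) (n : nat) (x : 'rV[R]_n) : R :=
  Num.sqrt (dot x x).

Definition argmin_set (R : realType) (T : Type) (f : T -> R) (C : set T) :
    set T :=
  [set x | C x /\ forall y, C y -> f x <= f y]%classic.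

(* The minimizer picked is the only one when C is nonempty, closed and convex;
   the default value 0 is taken when there is no minimizer. *)
Definition proj (R : realType) (n : nat) (C : set 'rV[R]_n) (z : 'rV[R]_n) :
    'rV[R]_n :=
  xget 0 (argmin_set (fun x => enorm (x - z)) C).

Definition Tcone (R : realType) (n : nat) : set 'rV[R]_n.+1 :=
  [set x | (forall i : 'I_n, x 0 (lift ord0 i) <= x 0 (lift ord_max i))
           /\ 0 <= x 0 ord_max]%classic.

Definition Delta (R : realType) (kappa : R) (n : nat) : set 'rV[R]_n :=
  [set x | (forall i, 0 <= x 0 i <= kappa)
           /\ \sum_(i < n) x 0 i = kappa]%classic.

(* y_k <= y_(k+1) at every position k between i and j. *)
Definition same_group (R : realType) (n : nat) (y : 'rV[R]_n.+1) :
    rel 'I_n.+1 :=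
  fun i j => [forall k : 'I_n, (minn i j <= k < maxn i j)%N ==>
                (y 0 (lift ord_max k) <= y 0 (lift ord0 k))].

Definition groups (R : realType) (n : nat) (y : 'rV[R]_n.+1) :
    {set {set 'I_n.+1}} :=
  equivalence_partition (same_group y) [set: 'I_n.+1].

(* y_P, for a partition P of the index set. *)
Definition group_avg (R : realType) (n : nat) (P : {set {set 'I_n}})
    (y : 'rV[R]_n) : 'rV[R]_n :=
  \row_i ((\sum_(k in finset.pblock P i) y 0 k) / #|finset.pblock P i|%:R).

Section Quantities.
Variables (R : realType) (n : nat) (z w : 'rV[R]_n.+1) (eps : R).

Definition ratio (i : 'I_n) : \bar R :=
  let dz := z 0 (lift ord_max i) - z 0 (lift ord0 i) in
  let dw := w 0 (lift ord_max i) - w 0 (lift ord0 i) in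
  if dw == 0 then +oo%E else (dz / dw)%:E.

Definition min_ratio : \bar R := (\big[mine/+oo]_(i < n) ratio i)%E.

Definition lambda0 : R :=
  (\sum_(i | z 0 ord_max < z 0 i) z 0 i * w 0 i - eps)
  / \sum_(i | z 0 ord_max < z 0 i) w 0 i ^+ 2.

Definition lambda1 : R := (dot z w - eps) / enorm w ^+ 2.

(* The 0-based version of n': it is n' - 1, and n.+1 if no index qualifies. *)
Definition first_neg : nat :=
  \big[minn/n.+1]_(k < n.+1 | z 0 k - lambda0 * w 0 k < 0) k.

Definition tail_groups : {set {set 'I_n.+1}} :=
  [set G in groups z | [forall i in G, (i < first_neg)%N]]
  :|: [set [set i : 'I_n.+1 | (first_neg <= i)%N]].

End Quantities.

(* NoRule: none of the tests (a)-(g) applies. *)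
Inductive outcome (V : Type) : Type :=
  | Exit of V
  | Next of V & V
  | NoRule.
Arguments NoRule {V}.

Section Algorithm.
Variables (R : realType) (n : nat) (eps : R).

(* One outer loop. The tests are tried in the order (a), ..., (g), so that from
   the fourth branch on lambda1 <= r < +oo holds. In the last two branches,
   inord only converts the index nn to 'I_n.+1, and nn <= n, resp. nn < n, is
   the 0-based form of n' <= N, resp. n' < N. *)
Definition pass (z w : 'rV[R]_n.+1) : outcome 'rV[R]_n.+1 :=
  let r := min_ratio z w in
  let l0 := lambda0 z w eps in
  let l1 := lambda1 z w eps in
  let nn := first_neg z w eps in
  let restart P := Next (group_avg P z) (group_avg P w) in
  if dot z w <= eps then Exit z
  else if r == +oo%E then Exit (proj (@Delta R (eps / w 0 ord0) n.+1) z)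
  else if (r < l1%:E)%E then restart (groups (z - l1 *: w))
  else if 0 <= z 0 ord_max - l1 * w 0 ord_max then Exit (z - l1 *: w)
  else if (r < l0%:E)%E then restart (groups (z - l0 *: w))
  else if (nn <= n)%N && (z 0 (inord nn) == z 0 ord_max) then
    Exit (\row_i Num.max (z 0 i - l0 * w 0 i) 0)
  else if (nn < n)%N && (z 0 (inord nn) != z 0 ord_max) then
    restart (tail_groups z w eps)
  else NoRule.

Fixpoint loop (m : nat) (z w : 'rV[R]_n.+1) : option 'rV[R]_n.+1 :=
  if m is m'.+1 then
    match pass z w with
    | Exit x => Some x
    | Next z' w' => loop m' z' w'
    | NoRule => None
    end
  else None.

(* Some x if the algorithm exits with output x during one of its first m outer
   loops (the exiting loop included), None otherwise. *)
Definition algorithmA (m : nat) (z w : 'rV[R]_n.+1) : option 'rV[R]_n.+1 :=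
  loop m z (group_avg (groups z) w).

End Algorithm.

(* Main.v *)
Require Import Defs.
From mathcomp Require Import all_boot all_order all_algebra.
From mathcomp Require Import boolp classical_sets reals constructive_ereal.
From mathcomp Require topology normedtype.
From mathcomp Require Import ring lra zify.

(* Let P_T be the projection onto the cone T, which can be computed by
   repeatedly averaging over the runs where the vector is nondecreasing. By
   the intermediate value theorem there is l >= 0 such that x = P_T (z - l w)
   satisfies <w, x> = eps; such an x is the minimizer. The pair (l, x) keeps
   this property when (z, w) is averaged over blocks on which x is constant,
   so it is enough to see that every restart averages over such blocks and
   merges two values of z, and that every exit returns x. Since w lies in T,
   testing the optimality of x against w gives l >= lambda1, and testing it
   against w cut off to { z_i > z_n } gives l >= lambda0 as soon as z_n -
   lambda1 w_n < 0. Hence x is constant wherever z - lambda w increases, for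
   the lambda in use, and vanishes wherever z - lambda0 w is negative. *)

Set Implicit Arguments.
Unset Strict Implicit.
Unset Printing Implicit Defensive.

Import Order.TTheory GRing.Theory Num.Theory.
Local Open Scope ring_scope.

(** * Inner product and the variational characterization of minimizers *)

Section Dot.
Context {R : realType} {n : nat}.
Implicit Types (x y z : 'rV[R]_n) (c : R).

Lemma dotC x y : dot x y = dot y x.
Proof. by apply: eq_bigr => i _; rewrite mulrC. Qed.

Lemma dotDl x y z : dot (x + y) z = dot x z + dot y z.
Proof. by rewrite -big_split; apply: eq_bigr => i _; rewrite mxE mulrDl. Qed.

Lemma dotZl c x y : dot (c *: x) y = c * dot x y.
Proof. by rewrite mulr_sumr; apply: eq_bigr => i _; rewrite mxE mulrA. Qed.

Lemma dotBl x y z : dot (x - y) z = dot x z - dot y z.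
Proof. by rewrite -scaleN1r dotDl dotZl mulN1r. Qed.

Lemma dotBr x y z : dot x (y - z) = dot x y - dot x z.
Proof. by rewrite dotC dotBl dotC (dotC x z). Qed.

Lemma dotZr c x y : dot x (c *: y) = c * dot x y.
Proof. by rewrite dotC dotZl dotC. Qed.

Lemma dot_ge0 x : 0 <= dot x x.
Proof. by apply: sumr_ge0 => i _; rewrite -expr2 sqr_ge0. Qed.

Lemma dot_le0 x : dot x x <= 0 -> x = 0.
Proof.
move=> xx; have /eqP : dot x x == 0 by rewrite eq_le xx dot_ge0.
have h i : true -> 0 <= x 0 i * x 0 i by rewrite -expr2 sqr_ge0.
move/(psumr_eq0P (fun i => h i)) => x0; apply/rowP => i; apply/eqP.
by have := x0 i isT => /eqP; rewrite mulf_eq0 orbb mxE.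
Qed.

Lemma enorm_sqr x : enorm x ^+ 2 = dot x x.
Proof. by rewrite sqr_sqrtr ?dot_ge0. Qed.

(** The obtuse-angle condition gives a Pythagorean inequality, hence minimality and uniqueness. Only
    the order induced by [f] matters, so [enorm] and half its square are treated together. *)
Lemma argmin_set_dist (f : 'rV[R]_n -> R) (C : set 'rV[R]_n) z x :
  (forall a b, (f a <= f b) = (dot (a - z) (a - z) <= dot (b - z) (b - z))) ->
  C x -> (forall y, C y -> dot (z - x) (y - x) <= 0) ->
  argmin_set f C = [set x]%classic.
Proof.
move=> fE Cx xP.
have pyth y : C y ->
    dot (x - z) (x - z) + dot (y - x) (y - x) <= dot (y - z) (y - z).
  move=> /xP; rewrite !dotBl !dotBr (dotC y x) (dotC z x) (dotC z y); lra.
apply/seteqP; split => [y [Cy ymin]|_ ->] /=.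
  have := ymin _ Cx; rewrite fE => yx.
  apply/eqP; rewrite -subr_eq0; apply/eqP/dot_le0.
  by have := pyth _ Cy; lra.
split=> // y Cy; rewrite fE.
by have := pyth _ Cy; have := dot_ge0 (y - x); lra.
Qed.

Lemma argmin_set_enorm (C : set 'rV[R]_n) z x :
  C x -> (forall y, C y -> dot (z - x) (y - x) <= 0) ->
  argmin_set (fun y => enorm (y - z)) C = [set x]%classic.
Proof. by apply: argmin_set_dist => a b; rewrite ler_sqrt ?dot_ge0. Qed.

Lemma argmin_set_sqr_enorm (C : set 'rV[R]_n) z x :
  C x -> (forall y, C y -> dot (z - x) (y - x) <= 0) ->
  argmin_set (fun y => 2^-1 * enorm (y - z) ^+ 2) C = [set x]%classic.
Proof.
by apply: argmin_set_dist => a b; rewrite ler_pM2l ?invr_gt0 // !enorm_sqr.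
Qed.

Lemma proj_eq (C : set 'rV[R]_n) z x :
  C x -> (forall y, C y -> dot (z - x) (y - x) <= 0) -> proj C z = x.
Proof.
by move=> Cx xP; rewrite /proj (argmin_set_enorm Cx xP);
have := @xgetPex _ 0 [set x]%classic; apply; exists x.
Qed.

End Dot.

Local Notation prev k := (lift ord_max k).
Local Notation next k := (lift ord0 k).

(** * From consecutive positions to arbitrary ones *)

Section Adjacent.
Context {n : nat}.

Lemma adjacent_trans (r : rel 'I_n.+1) (i j : 'I_n.+1) :
  reflexive r -> transitive r -> (i <= j)%N ->
  (forall k : 'I_n, (i <= k < j)%N -> r (prev k) (next k)) -> r i j.
Proof.
move=> rr rt; case: i j => i hi [j hj] /= ij.
have eqr (j' : nat) (hj' : (j' < n.+1)%N) : i = j' -> r (Ordinal hi) (Ordinal hj').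
  by move=> e; suff -> : Ordinal hi = Ordinal hj' by []; apply: val_inj.
elim: j hj ij => [|j IH] hj ij h.
  by apply: eqr; apply/eqP; rewrite -leqn0.
move: ij; rewrite leq_eqVlt => /predU1P[/eqr->//|ij].
have hj' : (j < n)%N by [].
have e1 : Ordinal (ltnW hj) = prev (Ordinal hj') by apply: ord_inj; rewrite lift_max.
apply: (rt (Ordinal (ltnW hj))).
  by apply: IH => // k /andP[ik kj]; apply: h; rewrite ik /= (ltn_trans kj (ltnSn j)).
have -> : Ordinal hj = next (Ordinal hj') by apply: val_inj.
by rewrite e1; apply: h; rewrite ltnSn -ltnS ij.
Qed.

End Adjacent.

(** * Projection onto the cone T *)

Section Cone.
Context {R : realType} {n : nat}.
Implicit Types (x y z w t u : 'rV[R]_n.+1).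

Lemma Tcone_le x (i j : 'I_n.+1) : Tcone x -> (i <= j)%N -> x 0 j <= x 0 i.
Proof.
move=> [xd _] ij.
apply: (@adjacent_trans _ (fun i j => x 0 j <= x 0 i)) => // a b c ab bc.
exact: le_trans bc ab.
Qed.

Lemma Tcone_ge0 x (i : 'I_n.+1) : Tcone x -> 0 <= x 0 i.
Proof.
move=> xT; apply: le_trans (@Tcone_le x i ord_max xT (leq_ord i)).
by case: xT.
Qed.

Lemma TconeP x : (forall i j : 'I_n.+1, (i <= j)%N -> x 0 j <= x 0 i) ->
  (forall i, 0 <= x 0 i) -> Tcone x.
Proof.
move=> xd x0; split=> // i; apply: xd.
by rewrite lift_max lift0.
Qed.

(** Moreau's conditions for [x] to be the projection of [u] onto the cone: the residual lies in the
    polar cone and is orthogonal to [x]. *)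
Definition is_projT u x :=
  [/\ Tcone x, forall t, Tcone t -> dot (u - x) t <= 0 & dot (u - x) x = 0].

Lemma is_projT_unique u x y : is_projT u x -> is_projT u y -> x = y.
Proof.
move=> [xT ux uxx] [yT uy uyy]; apply/eqP; rewrite -subr_eq0; apply/eqP/dot_le0.
move: (ux _ yT) (uy _ xT) uxx uyy; rewrite !dotBl !dotBr (dotC y x); lra.
Qed.

Lemma is_projT_max u : (forall i : 'I_n, u 0 (next i) <= u 0 (prev i)) ->
  is_projT u (\row_i Num.max (u 0 i) 0).
Proof.
move=> ud.
have uE (i : 'I_n.+1) : (u - \row_i Num.max (u 0 i) 0) 0 i = Num.min (u 0 i) 0.
  by rewrite !mxE; case: (leP (u 0 i) 0); lra.
split.
- split=> [i|]; rewrite !mxE; last by rewrite le_max lexx orbT.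
  by rewrite ge_max !le_max ud lexx orbT.
- move=> t tT; apply: sumr_le0 => i _; rewrite uE mulr_le0_ge0 ?Tcone_ge0 //.
  by rewrite ge_min lexx orbT.
- apply: big1 => i _; rewrite uE mxE.
  by case: (leP (u 0 i) 0); lra.
Qed.

Lemma is_projT_id u : Tcone u -> is_projT u u.
Proof.
by move=> uT; split=> // [t _|]; rewrite subrr /dot big1 // => i _; rewrite mxE mul0r.
Qed.

(** If [x] dropped by d > 0 at [k], replacing both entries by their mean would give a better point
    [t] of the cone. *)
Lemma is_projT_merge u x (k : 'I_n) : is_projT u x ->
  u 0 (prev k) <= u 0 (next k) -> x 0 (prev k) = x 0 (next k).
Proof.
move=> [xT ux uxx] uk; apply/eqP; rewrite eq_le; case: (xT) => xd x0.
rewrite xd andbT leNgt; apply/negP => xk.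
pose m := (x 0 (prev k) + x 0 (next k)) / 2.
pose t : 'rV[R]_n.+1 :=
  \row_i if i == prev k then m else if i == next k then m else x 0 i.
have nk : prev k != next k.
  by apply/eqP => /(congr1 (@nat_of_ord _)); rewrite lift_max lift0; exact: n_Sn.
have tT : Tcone t.
  apply: TconeP => [i j ij|i]; rewrite !mxE; last first.
    have [a b] := (Tcone_ge0 (prev k) xT, Tcone_ge0 (next k) xT).
    by do 2 (case: ifP => _; first by rewrite /m; lra); exact: Tcone_ge0.
  have xij := Tcone_le xT ij.
  have low (a : 'I_n.+1) : (a <= prev k)%N -> x 0 (prev k) <= x 0 a by apply: Tcone_le.
  have high (a : 'I_n.+1) : (next k <= a)%N -> x 0 a <= x 0 (next k) by apply: Tcone_le.
  have between (a : 'I_n.+1) : (a < next k)%N -> (a <= prev k)%N by rewrite lift_max lift0.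
  have between' (a : 'I_n.+1) : (prev k < a)%N -> (next k <= a)%N by rewrite lift_max lift0.
  have mE : m *+ 2 = x 0 (prev k) + x 0 (next k) by rewrite -mulr_natr divfK ?pnatr_eq0.
  case: (eqVneq i (prev k)) => [ei|ni].
    case: (eqVneq j (prev k)) => [//|nj]; case: (eqVneq j (next k)) => [//|nj'].
    have /high : (next k <= j)%N.
      rewrite between' // ltn_neqAle -ei ij andbT.
      by apply: contra nj => /eqP/ord_inj <-; rewrite ei.
    by lra.
  case: (eqVneq i (next k)) => [ei|ni'].
    case: (eqVneq j (prev k)) => [ej|nj].
      by move: ij; rewrite ei ej lift_max lift0 ltnn.
    case: (eqVneq j (next k)) => [//|nj'].
    have := high j; rewrite -ei ij => /(_ isT); rewrite ei; lra.
  case: (eqVneq j (prev k)) => [ej|nj].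
    by have := low i; rewrite -ej ij => /(_ isT); rewrite ej; lra.
  case: (eqVneq j (next k)) => [ej|//].
  have /low : (i <= prev k)%N.
    rewrite between // ltn_neqAle -ej ij andbT.
    by apply: contra ni' => /eqP/ord_inj ->; rewrite ej.
  by lra.
(* Orthogonality to [x] turns the test against [t] into 0 <= <u - x, x - t>. Only two terms survive;
   they add up to ((u_k - u_(k+1)) - d) d / 2 < 0. *)
have := ux _ tT; rewrite -[X in _ <= X]uxx -subr_ge0 -dotBr /dot.
rewrite (bigD1 (prev k)) //= (bigD1 (next k)) 1?eq_sym //= big1 => [|i /andP[ni ni']].
  by rewrite addr0 !mxE eqxx eqxx [next k == _]eq_sym (negbTE nk) /m; nra.
by rewrite !mxE (negbTE ni) (negbTE ni') subrr mulr0.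
Qed.

(** Cutting [x] to 0 on the up-closed set [S] stays in the cone. Testing against it makes the sum of
    (u_i - x_i) x_i over [S] nonnegative, though every term is nonpositive, and negative when x_i >
    0. *)
Lemma is_projT_tail0 u x (S : pred 'I_n.+1) : is_projT u x ->
  (forall i j : 'I_n.+1, (i <= j)%N -> S i -> S j) ->
  (forall i, S i -> u 0 i < 0) -> forall i, S i -> x 0 i = 0.
Proof.
move=> [xT ux uxx] Sup uS i Si; apply/eqP.
pose t : 'rV[R]_n.+1 := \row_i if S i then 0 else x 0 i.
have tT : Tcone t.
  apply: TconeP => [j k jk|j]; rewrite !mxE; last by case: ifP; rewrite ?Tcone_ge0.
  case: ifP => Sk; case: ifP => Sj //; rewrite ?Tcone_ge0 ?Tcone_le //.
  by rewrite (Sup _ _ jk Sj) in Sk.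
have := ux _ tT; rewrite -[X in _ <= X]uxx -subr_ge0 -dotBr /dot => le0.
have F j : (u - x) 0 j * (x - t) 0 j <= 0.
  rewrite !mxE; case: ifP => Sj; rewrite ?subrr ?mulr0 // subr0.
  by have := uS _ Sj; have := Tcone_ge0 j xT; nra.
have : \sum_(j < n.+1) (u - x) 0 j * (x - t) 0 j <= (u - x) 0 i * (x - t) 0 i.
  by rewrite (bigD1 i) //= gerDl sumr_le0.
rewrite !mxE Si subr0 => h; rewrite eq_le Tcone_ge0 // andbT.
by have := uS _ Si; have := Tcone_ge0 i xT; nra.
Qed.

End Cone.

(** * Averaging over blocks, and existence of the projection *)

Section Averaging.
Context {R : realType} {n : nat}.
Implicit Types (x y z w t u : 'rV[R]_n.+1) (b : pred 'I_n) (i j : 'I_n.+1).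

(* [b k] says that the positions [k] and [k + 1] are merged; the blocks are the
   maximal intervals of positions merged in this way. *)
Definition linked b : rel 'I_n.+1 := fun i j =>
  [forall k : 'I_n, (minn i j <= k < maxn i j)%N ==> b k].

Definition block b i : {set 'I_n.+1} := [set j | linked b i j].

Definition average b y : 'rV[R]_n.+1 :=
  \row_i ((\sum_(k in block b i) y 0 k) / #|block b i|%:R).

Lemma linked_refl b : reflexive (linked b).
Proof. by move=> i; apply/forallP => k; rewrite minnn maxnn; apply/implyP; lia. Qed.

Lemma linked_sym b : symmetric (linked b).
Proof. by move=> i j; rewrite /linked minnC maxnC. Qed.

Lemma linked_trans b : transitive (linked b).
Proof.
move=> j i l /forallP ij /forallP jl; apply/forallP => k; apply/implyP => kil.
have /orP[h|h] : ((minn i j <= k < maxn i j) || (minn j l <= k < maxn j l))%N.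
- by move: kil; lia.
- exact: (implyP (ij k)).
- exact: (implyP (jl k)).
Qed.

Lemma linked_equiv b : {in [set: 'I_n.+1] & &, equivalence_rel (linked b)}.
Proof.
move=> i j l _ _ _; split; first exact: linked_refl.
by move=> ij; apply/idP/idP; apply: linked_trans; rewrite // linked_sym.
Qed.

Lemma linked_next b k : linked b (prev k) (next k) = b k.
Proof.
apply/forallP/idP => [/(_ k)/implyP|bk l]; first by apply; rewrite lift_max lift0; lia.
apply/implyP; rewrite lift_max lift0 => h.
by have -> : l = k by apply: ord_inj; lia.
Qed.

Lemma linked_eq b y i j :
  (forall k, b k -> y 0 (prev k) = y 0 (next k)) -> linked b i j -> y 0 i = y 0 j.
Proof.
move=> by_; wlog ij : i j / (i <= j)%N.
  by move=> h; case: (leqP i j) => [/h//|/ltnW/h + l]; rewrite linked_sym => /(_ l).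
move=> /forallP l; apply/eqP.
apply: (@adjacent_trans _ (fun i j => y 0 i == y 0 j)) => // [a c d /eqP -> //|k hk].
by apply/eqP/by_/(implyP (l k)); move: hk; lia.
Qed.

Lemma linked_le b u i j : (forall k, b k -> u 0 (prev k) <= u 0 (next k)) ->
  (i <= j)%N -> linked b i j -> u 0 i <= u 0 j.
Proof.
move=> bu ij /forallP l.
apply: (@adjacent_trans _ (fun i j => u 0 i <= u 0 j)) => // [a c d|k hk].
  exact: le_trans.
by apply/bu/(implyP (l k)); move: hk; lia.
Qed.

Lemma block_eq b i j : linked b i j -> block b i = block b j.
Proof.
move=> ij; apply/setP => k; rewrite !inE; apply/idP/idP; apply: linked_trans => //.
by rewrite linked_sym.
Qed.

Lemma card_block_gt0 b i : 0 < #|block b i|%:R :> R.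
Proof. by rewrite ltr0n; apply/card_gt0P; exists i; rewrite inE linked_refl. Qed.

Lemma average_linked b y i j : linked b i j -> average b y 0 i = average b y 0 j.
Proof. by move=> /block_eq e; rewrite !mxE e. Qed.

Lemma average_next b y k : b k -> average b y 0 (prev k) = average b y 0 (next k).
Proof. by move=> bk; apply: average_linked; rewrite linked_next. Qed.

Lemma le_average b y i c : (forall j, linked b i j -> c <= y 0 j) -> c <= average b y 0 i.
Proof.
move=> cy; rewrite mxE ler_pdivlMr ?card_block_gt0 // mulr_natr -sumr_const.
by apply: ler_sum => j; rewrite inE => /cy.
Qed.

Lemma average_le b y i c : (forall j, linked b i j -> y 0 j <= c) -> average b y 0 i <= c.
Proof.
move=> cy; rewrite mxE ler_pdivrMr ?card_block_gt0 // mulr_natr -sumr_const.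
by apply: ler_sum => j; rewrite inE => /cy.
Qed.

Lemma average_id b y : (forall k, b k -> y 0 (prev k) = y 0 (next k)) -> average b y = y.
Proof.
move=> by_; apply/rowP => i; apply/eqP; rewrite eq_le.
by rewrite average_le ?le_average // => j /(linked_eq by_) ->.
Qed.

Lemma averageB b y (l : R) z :
  average b (y - l *: z) = average b y - l *: average b z.
Proof.
apply/rowP => i; rewrite !mxE mulrA -mulrBl mulr_sumr -sumrB.
by congr (_ / _); apply: eq_bigr => k _; rewrite !mxE.
Qed.

Lemma dot_averageE b y z : dot (average b y) z =
  \sum_i \sum_j (linked b i j)%:R / #|block b i|%:R * (y 0 j * z 0 i).
Proof.
apply: eq_bigr => i _; rewrite mxE mulr_suml mulr_suml [RHS](bigID (linked b i)) /=.
rewrite [X in _ + X]big1 ?addr0 => [|j /negbTE ->]; last by rewrite !mul0r.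
apply: eq_big => [j|j]; rewrite inE // => ->.
by rewrite (_ : true%:R = 1) //; ring.
Qed.

(** Linked positions share their block, so the kernel of the averaging operator is symmetric. *)
Lemma dot_average b y z : dot (average b y) z = dot y (average b z).
Proof.
rewrite [RHS]dotC !dot_averageE exchange_big; apply: eq_bigr => i _.
apply: eq_bigr => j _; rewrite linked_sym; case: (boolP (linked b i j)) => [/block_eq ->|_].
  by ring.
by rewrite !mul0r.
Qed.

(** At an unmerged [k], the block of [k + 1] lies to its right and the block of [k] to its left, so
    t_(k+1) and t_k separate the two means. *)
Lemma average_Tcone b t : Tcone t -> Tcone (average b t).
Proof.
move=> tT; split=> [k|]; last by apply: le_average => j _; exact: Tcone_ge0.
have [bk|nbk] := boolP (b k); first by rewrite average_next.
have tk : t 0 (next k) <= t 0 (prev k) by case: tT.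
apply: (@le_trans _ _ (t 0 (next k))).
  apply: average_le => j /forallP /(_ k); rewrite (negbTE nbk) implybF lift0 => h.
  by apply: Tcone_le => //; rewrite lift0; move: h; lia.
apply: (le_trans tk); apply: le_average => j /forallP /(_ k).
rewrite (negbTE nbk) implybF lift_max => h.
by apply: Tcone_le => //; rewrite lift_max; move: h; lia.
Qed.

Lemma average_break b t k : Tcone t -> ~~ b k ->
  t 0 (next k) < t 0 (prev k) ->
  average b t 0 (next k) < average b t 0 (prev k).
Proof.
move=> tT nbk tk; apply: (@le_lt_trans _ _ (t 0 (next k))).
  apply: average_le => j /forallP /(_ k); rewrite (negbTE nbk) implybF lift0 => h.
  by apply: Tcone_le => //; rewrite lift0; move: h; lia.
apply: (lt_le_trans tk); apply: le_average => j /forallP /(_ k).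
rewrite (negbTE nbk) implybF lift_max => h.
by apply: Tcone_le => //; rewrite lift_max; move: h; lia.
Qed.

(* Chebyshev's sum inequality on each block, by symmetrizing the double sum
   of [(u_j - u_i) (t_j - t_i)]. *)
Lemma dot_average_le b u t :
  (forall k, b k -> u 0 (prev k) <= u 0 (next k)) -> Tcone t ->
  dot u t <= dot (average b u) t.
Proof.
move=> bu tT.
pose c i j : R := (linked b i j)%:R / #|block b i|%:R.
have cC i j : c i j = c j i.
  by rewrite /c linked_sym; case: (boolP (linked b j i)) => [/block_eq ->|]; rewrite ?mul0r.
have c0 i j : 0 <= c i j by rewrite divr_ge0.
have E : dot u t = \sum_i \sum_j c i j * (u 0 i * t 0 i).
  apply: eq_bigr => i _; rewrite -mulr_suml -[LHS]mul1r; congr (_ * _).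
  rewrite -mulr_suml (_ : \sum_j _ = #|block b i|%:R).
    by rewrite divff // gt_eqF ?card_block_gt0.
  rewrite -natr_sum -sum1_card [in RHS]big_mkcond; congr _%:R.
  by apply: eq_bigr => j _; rewrite inE; case: linked.
have E' : dot u t = \sum_i \sum_j c i j * (u 0 j * t 0 j).
  rewrite E exchange_big; apply: eq_bigr => i _; apply: eq_bigr => j _.
  by rewrite cC.
have F : dot (average b u) t = \sum_i \sum_j c i j * (u 0 j * t 0 i) by exact: dot_averageE.
have F' : dot (average b u) t = \sum_i \sum_j c i j * (u 0 i * t 0 j).
  rewrite F exchange_big; apply: eq_bigr => i _; apply: eq_bigr => j _.
  by rewrite cC.
suff : dot u t + dot u t <= dot (average b u) t + dot (average b u) t by lra.
rewrite {1}E E' {1}F F' -!big_split; apply: ler_sum => i _ /=.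
rewrite -!big_split; apply: ler_sum => j _ /=.
rewrite -!mulrDr /c; case: (boolP (linked b i j)) => lij; last by rewrite !mul0r.
rewrite ler_wpM2l //; first by have := c0 i j; rewrite /c lij.
case: (leqP i j) => ij.
  by have := linked_le bu ij lij; have := Tcone_le tT ij; nra.
rewrite linked_sym in lij; have := linked_le bu (ltnW ij) lij.
by have := Tcone_le tT (ltnW ij); nra.
Qed.

Lemma is_projT_average b u x : is_projT u x ->
  (forall k, b k -> x 0 (prev k) = x 0 (next k)) -> is_projT (average b u) x.
Proof.
move=> [xT ux uxx] /average_id bx; split=> // [t tT|].
  by rewrite dotBl dot_average -{1}bx dot_average -dotBl; apply/ux/average_Tcone.
by rewrite dotBl dot_average bx -dotBl.
Qed.

(** Averaging over nondecreasing runs of [u] can only increase its pairing with the cone, so the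
    polar condition passes back to [u]. The averaged vector has ties inside blocks, so [x] is
    constant there and orthogonality transfers too. *)
Lemma is_projT_of_average b u x :
  (forall k, b k -> u 0 (prev k) <= u 0 (next k)) ->
  is_projT (average b u) x -> is_projT u x.
Proof.
move=> bu px; have bx : average b x = x.
  by apply: average_id => k bk; apply: (is_projT_merge px); rewrite average_next.
case: px => xT ux uxx; split=> // [t tT|].
  have := ux _ tT; have := dot_average_le bu tT; rewrite !dotBl; lra.
by move: uxx; rewrite !dotBl dot_average bx.
Qed.

(** The termination measure, both for the construction of the projection and for the algorithm. *)
Definition breaks y := #|[set k | y 0 (prev k) != y 0 (next k)]|.

Lemma breaks_average b y : (forall k, y 0 (prev k) = y 0 (next k) -> b k) ->
  (exists2 k, b k & y 0 (prev k) != y 0 (next k)) ->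
  (breaks (average b y) < breaks y)%N.
Proof.
move=> yb [k bk yk]; apply/proper_card/properP; split.
  apply/fintype.subsetP => l; rewrite !inE; apply: contra => /eqP/yb bl.
  by rewrite average_next.
by exists k; rewrite !inE // average_next // eqxx.
Qed.

(** Pool adjacent violators: each averaging round that is needed removes a break, until [u] is
    nonincreasing and its positive part is the projection. *)
Lemma is_projT_exists u : exists x, is_projT u x.
Proof.
have [m] := ubnP (breaks u); elim: m u => // m IH u um.
have [ud|/existsNP[k /negP]] := pselect (forall k, u 0 (next k) <= u 0 (prev k)).
  by eexists; apply: is_projT_max.
rewrite -ltNge => uk.
pose b k := u 0 (prev k) <= u 0 (next k).
have bu k' : b k' -> u 0 (prev k') <= u 0 (next k') by [].
have [] := IH (average b u).
  rewrite -ltnS; apply: leq_trans um; rewrite ltnS; apply: breaks_average.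
    by move=> l; rewrite /b => ->.
  by exists k; [exact: ltW|rewrite lt_eqF].
by move=> x /(is_projT_of_average bu); exists x.
Qed.

End Averaging.

(** * Existence of the multiplier by the intermediate value theorem *)

Section Multiplier.
Import topology normedtype numFieldNormedType.Exports.
Context {R : realType} {n : nat}.
Implicit Types (x y z w t u : 'rV[R]_n.+1).

Lemma dot_sqr_le x y c : dot y y <= c * dot x y -> dot x y ^+ 2 <= c * dot x y * dot x x.
Proof.
move=> yy; have [x0|x0] := eqVneq (dot x x) 0.
  have /dot_le0 -> : dot x x <= 0 by rewrite x0.
  by rewrite /dot !big1 ?mulr0 ?expr0n // => i _; rewrite mxE mul0r.
have xx : 0 < dot x x by rewrite lt_neqAle eq_sym x0 dot_ge0.
(* The square of this vector gives the Cauchy-Schwarz inequality. *)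
have := dot_ge0 (dot x x *: y - dot x y *: x).
rewrite !dotBl !dotBr !dotZl !dotZr (dotC y x) => h.
have : 0 <= dot x x * (dot x x * dot y y - dot x y ^+ 2) by lra.
have : dot x x * dot y y <= dot x x * (c * dot x y) by rewrite ler_wpM2l // ltW.
rewrite pmulr_rge0 //.
lra.
Qed.

(** Adding the four optimality conditions gives |x - y|^2 <= (m - l) <w, x - y>; Cauchy-Schwarz then
    bounds <w, x - y>^2 by (m - l) <w, x - y> |w|^2. *)
Lemma dot_projT_lipschitz z w l m x y :
  is_projT (z - l *: w) x -> is_projT (z - m *: w) y ->
  `|dot w x - dot w y| <= dot w w * `|l - m|.
Proof.
move=> [xT ux uxx] [yT uy uyy].
have /dot_sqr_le : dot (x - y) (x - y) <= (m - l) * dot w (x - y).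
  move: (ux _ yT) (uy _ xT) uxx uyy.
  rewrite !dotBr !dotBl !dotZl (dotC y x); lra.
rewrite -dotBr; set a := dot w (x - y) => h.
have [->|a0] := eqVneq a 0; first by rewrite normr0 mulr_ge0 ?dot_ge0.
rewrite -(ler_pM2l (x := `|a|)) ?normr_gt0 //.
rewrite -normrM -expr2 ger0_norm ?sqr_ge0 //; apply: (le_trans h).
rewrite mulrCA [leRHS]mulrC ler_wpM2r ?dot_ge0 //.
by rewrite (distrC l) mulrC -normrM ler_norm.
Qed.

Lemma Tcone_head_gt0 w : Tcone w -> w <> 0 -> 0 < w 0 ord0.
Proof.
move=> wT w0; rewrite lt_neqAle Tcone_ge0 // andbT eq_sym; apply/eqP => h.
apply: w0; apply/rowP => i; apply/eqP.
by rewrite mxE eq_le Tcone_ge0 // andbT -h Tcone_le.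
Qed.

(** Here |x|^2 = <z, x> - l <w, x>, where <z, x> is at most (n + 1) z_1 x_1 and <w, x> is at least
    w_1 x_1. *)
Lemma projT_eq0 z w l x : Tcone z -> Tcone w -> 0 <= l ->
  is_projT (z - l *: w) x -> n.+1%:R * z 0 ord0 <= l * w 0 ord0 -> x = 0.
Proof.
move=> zT wT l0 [xT _ uxx] zw; apply: dot_le0.
have x0 := Tcone_ge0 ord0 xT.
have zx : dot z x <= n.+1%:R * z 0 ord0 * x 0 ord0.
  rewrite -mulrA mulr_natl -[X in _ *+ X](card_ord n.+1) -sumr_const.
  by apply: ler_sum => i _; rewrite ler_pM ?Tcone_ge0 ?Tcone_le.
have wx : w 0 ord0 * x 0 ord0 <= dot w x.
  rewrite /dot (bigD1 ord0) //= lerDl sumr_ge0 // => i _.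
  by rewrite mulr_ge0 ?Tcone_ge0.
have : n.+1%:R * z 0 ord0 * x 0 ord0 <= l * w 0 ord0 * x 0 ord0 by rewrite ler_wpM2r.
have : l * (w 0 ord0 * x 0 ord0) <= l * dot w x by rewrite ler_wpM2l.
by move: uxx; rewrite !dotBl dotZl; lra.
Qed.

Lemma multiplier_exists z w (eps : R) : Tcone z -> Tcone w -> 0 < eps -> eps < dot z w ->
  exists (l : R) x, [/\ 0 <= l, is_projT (z - l *: w) x & dot w x = eps].
Proof.
move=> zT wT eps0 zw.
have [p pP] := choice (@is_projT_exists R n).
(* At 0 the projection is [z] itself and [f] exceeds [eps]; for a large argument the projection is
   0. *)
pose f l := dot w (p (z - l *: w)).
have f0 : f 0 = dot z w.
  by rewrite /f scale0r subr0 dotC (is_projT_unique (pP z) (is_projT_id zT)).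
have [M M0 fM] : exists2 M : R, 0 <= M & f M <= 0.
  have w0 : 0 < w 0 ord0.
    apply: Tcone_head_gt0 => // w0; move: zw; rewrite w0 /dot big1 ?ltNge ?ltW // => i _.
    by rewrite mxE mulr0.
  have M0 : 0 <= n.+1%:R * z 0 ord0 / w 0 ord0.
    by rewrite divr_ge0 ?mulr_ge0 ?Tcone_ge0.
  exists (n.+1%:R * z 0 ord0 / w 0 ord0) => //.
  rewrite /f (projT_eq0 zT wT M0 (pP _)) ?divfK ?gt_eqF //.
  by rewrite /dot big1 // => i _; rewrite mxE mulr0.
have cf : (continuous f)%classic.
  move=> l; apply/cvgrPdist_le => e e0.
  have d0 : 0 < e / (dot w w + 1) by rewrite divr_gt0 // ltr_wpDl ?dot_ge0.
  have /cvgrPdist_le /(_ _ d0) : (id @ l --> l)%classic by exact: cvg_id.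
  apply: filterS => m /= lm.
  apply: (le_trans (dot_projT_lipschitz (pP _) (pP _))).
  rewrite ler_pdivlMr ?ltr_wpDl ?dot_ge0 // in lm.
  by apply: le_trans lm; rewrite mulrDr mulrC mulr1 lerDl.
have [|l lM fl] := @IVT R f 0 M eps M0 (continuous_subspaceT cf).
  rewrite ge_min le_max f0; apply/andP; split; apply/orP; [right|left]; lra.
exists l, (p (z - l *: w)); split=> //.
by move: lM; rewrite in_itv => /andP[].
Qed.

End Multiplier.

(** * The quantities computed in one outer loop *)

Section Quantities.
Context {R : realType} {n : nat}.
Implicit Types (x y z w t u : 'rV[R]_n.+1) (b : pred 'I_n) (i j : 'I_n.+1) (eps l : R).

Lemma min_ratio_ge z w l : Tcone z -> Tcone w -> ~~ (min_ratio z w < l%:E)%E ->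
  forall k, (z - l *: w) 0 (next k) <= (z - l *: w) 0 (prev k).
Proof.
move=> zT wT; rewrite -leNgt => /bigmin_geP[_ rl] k.
have zk : z 0 (next k) <= z 0 (prev k) by case: zT.
have wk : w 0 (next k) <= w 0 (prev k) by case: wT.
(* An infinite ratio gives no bound on [l], but then [w] is flat at [k] and [z] alone decides. *)
have := rl k isT; rewrite /Defs.ratio /= !mxE; case: ifPn => [/eqP dw _|dw].
  by rewrite (_ : w 0 (prev k) = w 0 (next k)); lra.
rewrite lee_fin ler_pdivlMr; first by lra.
by rewrite lt_neqAle eq_sym dw subr_ge0.
Qed.

Lemma min_ratio_lt z w l : Tcone w -> (min_ratio z w < l%:E)%E ->
  exists k, w 0 (prev k) != w 0 (next k) /\
            (z - l *: w) 0 (prev k) < (z - l *: w) 0 (next k).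
Proof.
move=> wT /bigmin_ltP[|[k _]]; first by rewrite ltNge leey.
have wk : w 0 (next k) <= w 0 (prev k) by case: wT.
rewrite /Defs.ratio /=; case: ifPn => //= dw.
have dw0 : 0 < w 0 (prev k) - w 0 (next k) by rewrite lt_neqAle eq_sym dw subr_ge0.
rewrite lte_fin ltr_pdivrMr // => h; exists k; rewrite !mxE -subr_eq0 dw; lra.
Qed.

Lemma min_ratio_pinfty z w :
  min_ratio z w = +oo%E <-> forall k, w 0 (prev k) = w 0 (next k).
Proof.
split=> [r k|wc].
  have /bigmin_geP[_ /(_ k isT)] : (+oo <= min_ratio z w)%E by rewrite r.
  by rewrite /Defs.ratio /=; case: ifPn => //; rewrite subr_eq0 => /eqP.
by rewrite /min_ratio big1_idem ?minxx // => k _; rewrite /Defs.ratio wc subrr eqxx.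
Qed.

Lemma first_neg_min z w eps i : (i < first_neg z w eps)%N ->
  0 <= z 0 i - lambda0 z w eps * w 0 i.
Proof.
rewrite leNgt; apply: contraTN => neg; rewrite -leqNgt /first_neg -minEnat -leEnat.
exact: (bigmin_le_cond _ (fun k : 'I_n.+1 => nat_of_ord k) neg).
Qed.

Lemma first_neg_neg z w eps : (first_neg z w eps <= n)%N ->
  let i : 'I_n.+1 := inord (first_neg z w eps) in
  z 0 i - lambda0 z w eps * w 0 i < 0.
Proof.
have : first_neg z w eps = n.+1 \/
  exists2 i : 'I_n.+1, z 0 i - lambda0 z w eps * w 0 i < 0 & first_neg z w eps = i.
- rewrite /first_neg; elim/big_rec: _ => [|i m neg [->|[j jneg ->]]]; first by left.
  + by right; exists i => //; apply/minn_idPl; rewrite ltnW.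
  + by right; rewrite /minn; case: ifP => _; [exists i|exists j].
by case=> [->|[i neg ->]]; rewrite ?ltnn // inord_val.
Qed.

Lemma group_avgE b (v : 'rV[R]_n.+1) :
  group_avg (equivalence_partition (linked b) [set: 'I_n.+1]) v = average b v.
Proof.
have blockE i : finset.pblock (equivalence_partition (linked b) [set: 'I_n.+1]) i = block b i.
  apply/setP => j; rewrite pblock_equivalence_partition ?inE //.
  exact: linked_equiv.
by apply/rowP => i; rewrite !mxE blockE.
Qed.

Lemma mem_linked_partition b (G : {set 'I_n.+1}) :
  reflect (exists i, G = block b i)
    (G \in equivalence_partition (linked b) [set: 'I_n.+1]).
Proof.
have e i : [set j in [set: 'I_n.+1] | linked b i j] = block b i.
  by apply/setP => j; rewrite !inE.
apply: (iffP imsetP) => [[i _ ->]|[i ->]]; first by exists i; rewrite e.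
by exists i; rewrite ?inE ?e.
Qed.

(** The strict drop of [z] just before [m] makes a group of [z] start at [m], so replacing the
    groups from [m] on by a single one amounts to merging every [k] with m <= k. *)
Lemma tail_groupsE z w eps (m := first_neg z w eps) : (m <= n)%N ->
  (forall k : 'I_n, k.+1 = m -> z 0 (next k) < z 0 (prev k)) ->
  tail_groups z w eps = equivalence_partition
    (linked (fun k => (z 0 (prev k) <= z 0 (next k)) || (m <= k)%N)) [set: 'I_n.+1].
Proof.
move=> mn zm; set b' := fun k : 'I_n => _.
pose b (k : 'I_n) := z 0 (prev k) <= z 0 (next k).
have sep i j : linked b' i j -> (m <= i)%N = (m <= j)%N.
  wlog ij : i j / (i <= j)%N.
    by move=> h; case: (leqP i j) => [/h//|/ltnW/h + l]; rewrite linked_sym => /(_ l).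
  move=> /forallP lij; apply/idP/idP => [mi|mj]; first exact: leq_trans ij.
  rewrite leqNgt; apply/negP => im.
  (* A block straddling [m] would merge the positions [m - 1] and [m], against the drop of [z]
     there. *)
  have kn : (m.-1 < n)%N by lia.
  have := lij (Ordinal kn); rewrite /b' /= implybE => /or3P[|h|]; last by lia.
    by lia.
  by move: h; rewrite leNgt zm //=; lia.
have tailE i : (m <= i)%N -> block b' i = [set j : 'I_n.+1 | (m <= j)%N].
  move=> mi; apply/setP => j; rewrite !inE; apply/idP/idP => [/sep <-//|mj].
  apply/forallP => k; apply/implyP => /andP[h _]; apply/orP; right.
  by apply: leq_trans h; rewrite leq_min mi.
have headE i : (i < m)%N -> block b' i = block b i.
  move=> im; apply/setP => j; rewrite !inE; apply/idP/idP => l.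
    apply/forallP => k; apply/implyP => h.
    have := implyP (forallP l k) h; rewrite /b' => /orP[//|mk]; exfalso.
    case/andP: h => _ kij; suff : (maxn i j <= m)%N.
      by move=> /(leq_trans kij); rewrite ltnNge mk.
    rewrite geq_max (ltnW im) leqNgt; apply/negP => /ltnW.
    by rewrite -(sep _ _ l) leqNgt im.
  apply/forallP => k; apply/implyP => h.
  by apply/orP; left; exact: (implyP (forallP l k) h).
apply/setP => G; rewrite /tail_groups !inE -/m.
apply/idP/mem_linked_partition =>
  [/orP[/andP[/mem_linked_partition[i ->] /forallP im]|/eqP ->]|[i ->]].
- exists i; rewrite headE //.
  by have := im i; rewrite inE linked_refl.
- by exists ord_max; rewrite tailE.
- have [mi|im] := leqP m i; first by rewrite tailE // eqxx orbT.
  apply/orP; left; rewrite headE //; apply/andP; split.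
    by apply/mem_linked_partition; exists i.
  apply/forallP => j; apply/implyP; rewrite -headE // inE => /sep.
  by rewrite !(leqNgt m) im => /esym/negbFE.
Qed.

End Quantities.

(** * Invariant, exits and restarts of the algorithm *)

Section Pass.
Context {R : realType} {n : nat}.
Implicit Types (x y z w t u : 'rV[R]_n.+1) (b : pred 'I_n) (i j : 'I_n.+1) (eps l c : R).

(* The multiplier [l] and the solution [x] stay the same during the whole run. *)
Definition kkt z w eps l x :=
  [/\ Tcone z, Tcone w, 0 <= l, is_projT (z - l *: w) x & dot w x = eps].

(** This is what averaging [w] over the groups of [z] establishes initially. It makes ties of [z]
    ties of [z - c w] for every [c], so restarts never split a tie. *)
Definition aligned z w := forall k : 'I_n,
  z 0 (prev k) = z 0 (next k) -> w 0 (prev k) = w 0 (next k).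

Lemma projT_feasible_dist z w l x y : is_projT (z - l *: w) x -> Tcone y ->
  dot w y = dot w x -> dot (z - x) (y - x) <= 0.
Proof.
move=> [xT ux uxx] /ux + wy; move: uxx; rewrite !dotBr !dotBl !dotZl wy; lra.
Qed.

(** Both points satisfy the variational inequality of the same constrained problem. The multipliers
    may differ, so an exit need not show that its own lambda equals [l]. *)
Lemma projT_feasible_unique z w l l' x y : is_projT (z - l *: w) x ->
  is_projT (z - l' *: w) y -> dot w x = dot w y -> x = y.
Proof.
move=> px py wxy.
have xT : Tcone x by case: px.
have yT : Tcone y by case: py.
have := projT_feasible_dist px yT (esym wxy); have := projT_feasible_dist py xT wxy.
rewrite !dotBl !dotBr (dotC y x) => a c; apply/eqP; rewrite -subr_eq0; apply/eqP/dot_le0.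
by rewrite !dotBl !dotBr (dotC y x); lra.
Qed.

Lemma aligned_eq z w i j : Tcone z -> aligned z w -> (i <= j)%N ->
  z 0 i = z 0 j -> w 0 i = w 0 j.
Proof.
move=> zT zw ij zij; apply/eqP.
apply: (@adjacent_trans _ (fun i j => w 0 i == w 0 j)) => // [a b d /eqP -> //|k /andP[ik kj]].
apply/eqP/zw/eqP; rewrite eq_le.
have h1 : z 0 (prev k) <= z 0 i by apply: Tcone_le => //; rewrite lift_max.
have h2 : z 0 j <= z 0 (next k) by apply: Tcone_le => //; rewrite lift0.
by rewrite -zij in h2; rewrite (le_trans h1 h2) /=; case: zT.
Qed.

Lemma kkt_average b z w eps l x : kkt z w eps l x ->
  (forall k, z 0 (prev k) = z 0 (next k) -> b k) ->
  (forall k, b k -> x 0 (prev k) = x 0 (next k)) ->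
  kkt (average b z) (average b w) eps l x /\ aligned (average b z) (average b w).
Proof.
move=> [zT wT l0 px wx] zb bx; split.
  split; rewrite -?averageB //; try exact: average_Tcone.
    exact: is_projT_average.
  by rewrite dot_average average_id.
move=> k zk; have [bk|nbk] := boolP (b k); first exact: average_next.
have := @average_break _ _ b z k zT nbk; rewrite zk ltxx => h.
suff /h : z 0 (next k) < z 0 (prev k) by [].
rewrite lt_neqAle; case: (zT) => -> _; rewrite andbT.
by apply: contra nbk => /eqP e; apply: zb.
Qed.

Section Invariant.
Context (z w : 'rV[R]_n.+1) (eps l : R) (x : 'rV[R]_n.+1)
  (eps_gt0 : 0 < eps) (hk : kkt z w eps l x) (hzw : aligned z w).

Let zT : Tcone z. Proof. by case: hk. Qed.
Let wT : Tcone w. Proof. by case: hk. Qed.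
Let l_ge0 : 0 <= l. Proof. by case: hk. Qed.
Let px : is_projT (z - l *: w) x. Proof. by case: hk. Qed.
Let wx : dot w x = eps. Proof. by case: hk. Qed.
Let xT : Tcone x. Proof. by case: px. Qed.

Lemma kkt_head_gt0 : 0 < w 0 ord0.
Proof.
apply: Tcone_head_gt0 => // w0; move: eps_gt0; rewrite -wx w0 /dot big1 ?ltxx // => i _.
by rewrite mxE mul0r.
Qed.

Lemma kkt_norm_gt0 : 0 < dot w w.
Proof.
rewrite /dot (bigD1 ord0) //= ltr_pwDl ?mulr_gt0 ?kkt_head_gt0 //.
by apply: sumr_ge0 => i _; rewrite -expr2 sqr_ge0.
Qed.

Lemma lambda1E : dot w (z - lambda1 z w eps *: w) = eps.
Proof.
rewrite dotBr dotZr /lambda1 enorm_sqr divfK ?gt_eqF ?kkt_norm_gt0 // (dotC w z).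
lra.
Qed.

(** Testing optimality against [w] reads <z, w> - l |w|^2 - eps <= 0. *)
Lemma lambda1_le : lambda1 z w eps <= l.
Proof.
case: px => _ /(_ _ wT) h _; rewrite /lambda1 enorm_sqr ler_pdivrMr ?kkt_norm_gt0 //.
by move: h; rewrite !dotBl dotZl (dotC x w) wx; lra.
Qed.

(** Optimality tested against [z] gives |z - x|^2 <= l (<z, w> - eps). *)
Lemma kkt_exit_a : dot z w <= eps -> z = x.
Proof.
move=> zw; case: px => _ /(_ _ zT) h1 h2; apply/eqP; rewrite -subr_eq0; apply/eqP/dot_le0.
have : l * dot z w <= l * eps by rewrite ler_wpM2l.
move: h1 h2; rewrite !dotBl !dotBr !dotZl wx (dotC x z) (dotC w z); lra.
Qed.

Lemma kkt_exit_b : (forall k : 'I_n, w 0 (prev k) = w 0 (next k)) ->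
  proj (@Delta R (eps / w 0 ord0) n.+1) z = x.
Proof.
move=> wc; set c := w 0 ord0; have c0 : 0 < c := kkt_head_gt0.
have wE i : w 0 i = c.
  apply/eqP; rewrite eq_sym.
  apply: (@adjacent_trans _ (fun i j => w 0 i == w 0 j)) => // [a b d /eqP -> //|k _].
  by rewrite wc.
have xE i : x 0 i = Num.max (z 0 i - l * c) 0.
  have/(is_projT_unique px) -> : is_projT (z - l *: w) (\row_i Num.max ((z - l *: w) 0 i) 0).
    by apply: is_projT_max => k; rewrite !mxE !wE lerB //; case: zT.
  by rewrite !mxE wE.
have sx : \sum_i x 0 i = eps / c.
  apply: (mulfI (lt0r_neq0 c0)); rewrite mulrCA divff ?gt_eqF // mulr1 -wx mulr_sumr.
  by apply: eq_bigr => i _; rewrite wE.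
apply: proj_eq => [|y [y0 sy]].
  split=> // i; rewrite Tcone_ge0 // -sx (bigD1 i) //= lerDl sumr_ge0 // => j _.
  exact: Tcone_ge0.
(* Both sums equal eps / c. Termwise, either z_i - x_i = l c, or x_i = 0 with z_i <= l c and y_i >=
   0. *)
have -> : 0 = \sum_i l * c * (y 0 i - x 0 i) by rewrite -mulr_sumr sumrB sx sy subrr mulr0.
apply: ler_sum => i _; rewrite !mxE xE; have /andP[yi _] := y0 i.
by case: (leP (z 0 i - l * c) 0) => ?; nra.
Qed.

Lemma kkt_exit_d : ~~ (min_ratio z w < (lambda1 z w eps)%:E)%E ->
  0 <= z 0 ord_max - lambda1 z w eps * w 0 ord_max -> z - lambda1 z w eps *: w = x.
Proof.
move=> r zn; have uT : Tcone (z - lambda1 z w eps *: w).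
  by split=> [i|]; [exact: min_ratio_ge|rewrite !mxE].
by apply: (projT_feasible_unique (is_projT_id uT) px); rewrite lambda1E.
Qed.

Lemma kkt_restart b : (forall k, z 0 (prev k) = z 0 (next k) -> b k) ->
  (forall k, b k -> x 0 (prev k) = x 0 (next k)) ->
  (exists2 k, b k & z 0 (prev k) != z 0 (next k)) ->
  [/\ kkt (average b z) (average b w) eps l x,
      aligned (average b z) (average b w) &
      (breaks (average b z) < breaks z)%N].
Proof.
by move=> zb bx br; have [? ?] := kkt_average hk zb bx; split=> //; exact: breaks_average.
Qed.

(** Serves [c] = [lambda1] and [c] = [lambda0]. As [w] is nonincreasing and c <= l, an ascent of
    [z - c w] is one of [z - l w], so [x] is constant there. *)
Lemma kkt_restart_groups c : (min_ratio z w < c%:E)%E -> c <= l ->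
  let P := groups (z - c *: w) in
  [/\ kkt (group_avg P z) (group_avg P w) eps l x,
      aligned (group_avg P z) (group_avg P w) &
      (breaks (group_avg P z) < breaks z)%N].
Proof.
move=> rc cl P; rewrite !group_avgE; apply: kkt_restart => [k zk|k|].
- by rewrite !mxE zk (hzw zk).
- rewrite !mxE => h; apply: (is_projT_merge px); rewrite !mxE.
  by have : w 0 (next k) <= w 0 (prev k) by [case: wT]; nra.
- have [k [wk uk]] := min_ratio_lt wT rc; exists k; first exact: ltW.
  by apply: contra wk => /eqP/hzw ->.
Qed.

Context (r_fin : min_ratio z w != +oo%E).

Lemma kkt_not_constant : z 0 ord_max < z 0 ord0.
Proof.
have [k wk] : exists k : 'I_n, w 0 (prev k) != w 0 (next k).
  apply: contrapT => h; move/eqP: r_fin; apply; apply/min_ratio_pinfty => k.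
  by apply/eqP; apply: contrapT => wk; apply: h; exists k; apply/negP.
have zk : z 0 (next k) < z 0 (prev k).
  rewrite lt_neqAle; case: (zT) => -> _; rewrite andbT.
  by apply: contra wk => /eqP e; rewrite hzw.
apply: (@le_lt_trans _ _ (z 0 (next k)));
  first exact: (@Tcone_le _ _ z _ ord_max zT (leq_ord _)).
by apply: (lt_le_trans zk); exact: Tcone_le.
Qed.

Lemma kkt_head_norm_gt0 : 0 < \sum_(i | z 0 ord_max < z 0 i) w 0 i ^+ 2.
Proof.
rewrite (bigD1 ord0) ?kkt_not_constant //= ltr_pwDl ?exprn_gt0 ?kkt_head_gt0 //.
by apply: sumr_ge0 => i _; rewrite sqr_ge0.
Qed.

Lemma lambda0E :
  \sum_(i | z 0 ord_max < z 0 i) w 0 i * (z 0 i - lambda0 z w eps * w 0 i) = eps.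
Proof.
rewrite (eq_bigr (fun i => z 0 i * w 0 i - lambda0 z w eps * w 0 i ^+ 2)); last first.
  by move=> i _; ring.
rewrite sumrB -mulr_sumr /lambda0 divfK ?gt_eqF ?kkt_head_norm_gt0 //.
lra.
Qed.

Let tail_w i : z 0 i = z 0 ord_max -> w 0 i = w 0 ord_max.
Proof. exact: (@aligned_eq z w i ord_max zT hzw (leq_ord i)). Qed.

Let not_headE i : ~~ (z 0 ord_max < z 0 i) -> z 0 i = z 0 ord_max.
Proof.
rewrite -leNgt => h; apply/eqP; rewrite eq_le h /=.
exact: (@Tcone_le _ _ z i ord_max zT (leq_ord i)).
Qed.

Context (tail_neg : z 0 ord_max - lambda1 z w eps * w 0 ord_max < 0).

Lemma lambda0_le : lambda0 z w eps <= l.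
Proof.
pose h : 'rV[R]_n.+1 := \row_i if z 0 ord_max < z 0 i then w 0 i else 0.
have hT : Tcone h.
  apply: TconeP => [i j ij|i]; rewrite !mxE; last by case: ifP => _ //; exact: Tcone_ge0.
  case: ifP => hj; last by case: ifP => _ //; exact: Tcone_ge0.
  by rewrite (lt_le_trans hj) ?Tcone_le.
(* On the tail z_i = z_n and w_i = w_n, and [lambda1] <= l makes z_n - l w_n negative. Hence cutting
   [w] to [h] does not change its pairing with [x]. *)
have x0 i : ~~ (z 0 ord_max < z 0 i) -> x 0 i = 0.
  apply: (is_projT_tail0 px (S := fun i => ~~ (z 0 ord_max < z 0 i))).
    by move=> j k jk; apply: contra => /lt_le_trans; apply; exact: Tcone_le.
  move=> j /not_headE zj; rewrite !mxE (tail_w zj) zj.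
  have := lambda1_le; have := Tcone_ge0 ord_max wT; move: tail_neg; nra.
have headE y : dot y h = \sum_(i | z 0 ord_max < z 0 i) y 0 i * w 0 i.
  by rewrite [RHS]big_mkcond; apply: eq_bigr => i _; rewrite mxE; case: ifP; rewrite ?mulr0.
have xh : dot x h = eps.
  rewrite headE -wx [RHS](bigID (fun i => z 0 ord_max < z 0 i)) /=.
  rewrite [X in _ + X]big1 ?addr0 => [|i /x0 ->]; last by rewrite mulr0.
  by apply: eq_bigr => i _; rewrite mulrC.
case: px => _ /(_ _ hT) + _; rewrite !dotBl dotZl xh !headE => zh.
rewrite /lambda0 ler_pdivrMr ?kkt_head_norm_gt0 //.
under [X in l * X]eq_bigr do rewrite expr2.
lra.
Qed.

Context (r_ge : ~~ (min_ratio z w < (lambda0 z w eps)%:E)%E).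
Let m := first_neg z w eps.

Let u_decr i j : (i <= j)%N ->
  z 0 j - lambda0 z w eps * w 0 j <= z 0 i - lambda0 z w eps * w 0 i.
Proof.
move=> ij; have := @adjacent_trans _ (fun i j =>
  (z - lambda0 z w eps *: w) 0 j <= (z - lambda0 z w eps *: w) 0 i) i j _ _ ij.
rewrite !mxE; apply=> // [a b d ab bd|k _]; first exact: le_trans bd ab.
exact: min_ratio_ge.
Qed.

Lemma kkt_first_neg_le : (m <= n)%N.
Proof.
rewrite leqNgt; apply/negP => nm.
have : 0 <= z 0 ord_max - lambda0 z w eps * w 0 ord_max by apply: first_neg_min.
apply/negP; rewrite -ltNge.
(* In <w, z - lambda1 w> = eps the tail contributes at most 0, so the head contributes at least
   [eps], whereas [lambda0] makes it exactly [eps]. *)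
have : lambda1 z w eps <= lambda0 z w eps; last first.
  by have := Tcone_ge0 ord_max wT; move: tail_neg; nra.
have := lambda1E; rewrite /dot (bigID (fun i => z 0 ord_max < z 0 i)) /=.
set T := (X in _ + X) => e.
have T0 : T <= 0.
  apply: sumr_le0 => i /not_headE zi; rewrite !mxE (tail_w zi) zi.
  by rewrite mulr_ge0_le0 ?Tcone_ge0 // ltW.
rewrite -(ler_pM2r kkt_head_norm_gt0) /lambda0 divfK ?gt_eqF ?kkt_head_norm_gt0 //.
move: e; under eq_bigr do rewrite !mxE mulrBr mulrCA -expr2 (mulrC (w 0 _)).
by rewrite sumrB -mulr_sumr; lra.
Qed.

Let first_neg_lt0 : z 0 (inord m) - lambda0 z w eps * w 0 (inord m) < 0.
Proof. exact/first_neg_neg/kkt_first_neg_le. Qed.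

(** The hypothesis puts the whole head before [m], so the output is z - lambda0 w on the head and 0
    on the tail, and [lambda0E] makes it feasible. *)
Lemma kkt_exit_f : z 0 (inord m) = z 0 ord_max ->
  \row_i Num.max (z 0 i - lambda0 z w eps * w 0 i) 0 = x.
Proof.
move=> zm; set y := \row_i _.
have py : is_projT (z - lambda0 z w eps *: w) y.
  have -> : y = \row_i Num.max ((z - lambda0 z w eps *: w) 0 i) 0.
    by apply/rowP => i; rewrite !mxE.
  by apply: is_projT_max; exact: min_ratio_ge.
apply: (projT_feasible_unique py px); rewrite wx -lambda0E /dot.
rewrite (bigID (fun i => z 0 ord_max < z 0 i)) /= [X in _ + X]big1 ?addr0.
  apply: eq_bigr => i zi; rewrite mxE max_l //; apply: first_neg_min.
  rewrite ltnNge; apply/negP => mi.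
  have : z 0 i <= z 0 (inord m) by apply: Tcone_le => //; rewrite inordK // ltnS kkt_first_neg_le.
  by rewrite zm leNgt zi.
move=> i /not_headE zi; rewrite mxE max_r ?mulr0 // (tail_w zi) zi ltW //.
by move: first_neg_lt0; rewrite (tail_w zm) zm.
Qed.

Lemma kkt_restart_tail : (m < n)%N -> z 0 (inord m) != z 0 ord_max ->
  let P := tail_groups z w eps in
  [/\ kkt (group_avg P z) (group_avg P w) eps l x,
      aligned (group_avg P z) (group_avg P w) &
      (breaks (group_avg P z) < breaks z)%N].
Proof.
move=> mn zm P.
have mE (k : 'I_n.+1) : k = m :> nat -> k = inord m by move=> <-; rewrite inord_val.
(* A tie would, by alignment, give z - lambda0 w the same value at [m - 1] and [m], but its sign
   changes there. *)
have zbreak (k : 'I_n) : k.+1 = m -> z 0 (next k) < z 0 (prev k).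
  move=> km; rewrite lt_neqAle; case: (zT) => -> _; rewrite andbT.
  apply/eqP => zk; have : 0 <= z 0 (prev k) - lambda0 z w eps * w 0 (prev k).
    by apply: first_neg_min; rewrite lift_max -/m -km.
  rewrite (hzw (esym zk)) -zk (mE (next k)) ?lift0 //.
  by rewrite leNgt first_neg_lt0.
rewrite /P tail_groupsE ?kkt_first_neg_le // !group_avgE.
apply: kkt_restart => [k ->|k /orP[zk|mk]|].
- by rewrite lexx.
- apply: (is_projT_merge px); have zk' : z 0 (next k) <= z 0 (prev k) by case: zT.
  have e : z 0 (prev k) = z 0 (next k) by apply/eqP; rewrite eq_le zk.
  by rewrite !mxE (hzw e) e.
- have x0 (i : 'I_n.+1) : (m <= i)%N -> x 0 i = 0.
    apply: (is_projT_tail0 px (S := fun i => (m <= i)%N)) => [i' j ij mi|j mj].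
      exact: leq_trans mi ij.
    have : ((inord m : 'I_n.+1) <= j)%N by rewrite inordK // ltnS ltnW.
    move/u_decr; have := lambda0_le; have := Tcone_ge0 j wT.
    by move: first_neg_lt0; rewrite !mxE; nra.
  by rewrite !x0 // ?lift_max ?lift0 // ltnW.
- apply: contrapT => h; move/eqP: zm; apply; apply/eqP.
  have le : ((inord m : 'I_n.+1) <= (ord_max : 'I_n.+1))%N by exact: leq_ord.
  apply: (@adjacent_trans _ (fun i j => z 0 i == z 0 j)) => // [a b d /eqP -> //|k /andP[mk _]].
  apply: contrapT => /negP zk; apply: h; exists k => //.
  by apply/orP; right; rewrite inordK // in mk; rewrite ltnS ltnW.
Qed.

End Invariant.

Lemma pass_kkt z w eps l x : 0 < eps -> kkt z w eps l x -> aligned z w ->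
  pass eps z w = Exit x \/
  exists z' w', [/\ pass eps z w = Next z' w', kkt z' w' eps l x, aligned z' w' &
                    (breaks z' < breaks z)%N].
Proof.
move=> e0 hk zw; rewrite /pass.
case: ifP => [/(kkt_exit_a hk) ->|_]; first by left.
have [/min_ratio_pinfty wc|r_fin] := eqVneq (min_ratio z w) +oo%E.
  by left; rewrite (kkt_exit_b e0 hk wc).
case: ifPn => [rl|r1].
  by right; do 2 eexists; split; first by [];
    have [] := kkt_restart_groups hk zw rl (lambda1_le e0 hk).
case: ifPn => [zn|]; first by left; rewrite (kkt_exit_d e0 hk r1 zn).
rewrite -ltNge => zn; have l0 := lambda0_le e0 hk zw r_fin zn.
case: ifPn => [rl|r0].
  by right; do 2 eexists; split; first by [];
    have [] := kkt_restart_groups hk zw rl l0.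
have mn := kkt_first_neg_le e0 hk zw r_fin zn.
rewrite mn /=; case: eqP => [zm|/eqP zm].
  by left; rewrite (kkt_exit_f e0 hk zw r_fin zn r0 zm).
(* For [first_neg] = n the index is [ord_max] and the previous test succeeds, so [NoRule] is never
   reached. *)
have mn' : (first_neg z w eps < n)%N.
  rewrite ltn_neqAle mn andbT; apply: contra zm => /eqP ->.
  by apply/eqP; congr (z 0 _); apply: ord_inj; rewrite inordK ?ltnSn.
rewrite mn' /=; right; do 2 eexists; split; first by [];
  by have [] := kkt_restart_tail e0 hk zw r_fin zn r0 mn' zm.
Qed.

Lemma loop_kkt m z w eps l x : 0 < eps -> kkt z w eps l x -> aligned z w ->
  (breaks z < m)%N -> loop eps m z w = Some x.
Proof.
move=> e0; elim: m z w => // m IH z w hk zw zm /=.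
have [->//|[z' [w' [-> hk' zw' lt]]]] := pass_kkt e0 hk zw.
by apply: IH => //; exact: leq_trans lt _.
Qed.

End Pass.

Theorem theorem1 (R : realType) (n : nat) (z w : 'rV[R]_n.+1) (eps : R)
    (hz : @Tcone R n z) (hw : @Tcone R n w) (hw0 : w <> 0)
    (heps : 0 < eps) (hzw : eps < dot z w) :
  exists xstar : 'rV[R]_n.+1,
    argmin_set (fun x : 'rV[R]_n.+1 => 2^-1 * enorm (x - z) ^+ 2)
      [set x : 'rV[R]_n.+1 |
        \sum_(i < n.+1) w 0 i * x 0 i = eps /\ @Tcone R n x]%classic
      = [set xstar]%classic
    /\ algorithmA eps n.+1 z w = Some xstar.
Proof.
have [l [x [l0 px wx]]] := multiplier_exists hz hw heps hzw.
have xT : Tcone x by case: px.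
exists x; split.
  apply: argmin_set_sqr_enorm => [//|y [wy yT]].
  by apply: (projT_feasible_dist px yT); rewrite wx.
(* As [z] is nonincreasing, [b] marks exactly its ties: averaging fixes [z], and the initialization
   of [w] is one more averaging that preserves [l] and [x]. *)
pose b (k : 'I_n) := z 0 (lift ord_max k) <= z 0 (lift ord0 k).
have hk : kkt z w eps l x by [].
have zb k : b k -> z 0 (lift ord_max k) = z 0 (lift ord0 k).
  by rewrite /b => zk; apply/eqP; rewrite eq_le zk /=; case: hz.
have [k|k bk|] := @kkt_average _ _ b _ _ _ _ _ hk; first by rewrite /b => ->.
  apply: (is_projT_merge px); rewrite !mxE (zb _ bk).
  have : w 0 (lift ord0 k) <= w 0 (lift ord_max k) by case: hw.
  by nra.
rewrite average_id // => hk' zw; rewrite /algorithmA group_avgE.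
apply: loop_kkt hk' zw _ => //.
(* There are at most n breaks, hence at most n restarts, and one more loop for the exit. *)
by rewrite ltnS -[leqRHS]card_ord max_card.
Qed.
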